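(* Let $d\in\mathbb N$ and let $X_1,\dots,X_d$ be arbitrary real-valued random variables on an atomless probability space (no integrability assumed). Then $$X_1+\cdots+X_d\le_{\rm cx} X_1^{\rm co}+\cdots+X_d^{\rm co},$$ where $(X_1^{\rm co},\dots,X_d^{\rm co})$ is a comonotonic version of $(X_1,\dots,X_d)$.
   Context: An expectation $\mathbb E[V]$ is well-defined if $\mathbb E[\max\{V,0\}]<\infty$ or $\mathbb E[\max\{-V,0\}]<\infty$. We write $U\le_{\rm cx}V$ if $\mathbb E[u(U)]\le\mathbb E[u(V)]$ for all convex $u:\mathbb R\to\mathbb R$ such that both expectations are well-defined. A pair $(X,Y)$ is comonotonic if $X=f(Z)$, $Y=g(Z)$ a.s. for some random variable $Z$ and increasing $f,g$; a random vector is comonotonic if each pair of its components is comonotonic. A comonotonic version of $(X_1,\dots,X_d)$ is a comonotonic random vector $(X_1',\dots,X_d')$ with $X_i'$ distributed as $X_i$ for each $i$. *)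

(* Defs.v *)
From HB Require Import structures.
From mathcomp Require Import all_boot all_order all_algebra.
From mathcomp Require Import all_classical all_reals all_analysis.
Set Implicit Arguments. Unset Strict Implicit. Unset Printing Implicit Defensive.
Import Order.TTheory GRing.Theory Num.Theory.
Local Open Scope classical_set_scope.
Local Open Scope ring_scope.

Section Defs.
Context {R : realType} {d : measure_display} {T : measurableType d}.
Variable P : probability T R.

Definition atomless : Prop :=
  forall A : set T, measurable A -> (0 < P A)%E ->
    exists B : set T, [/\ measurable B, B `<=` A, (0 < P B)%E & (P B < P A)%E].

Definition convex_fun (u : R -> R) : Prop :=
  forall (x y t : R), 0 <= t <= 1 ->
    u (t * x + (1 - t) * y) <= t * u x + (1 - t) * u y.

Definition expect_welldef (V : T -> R) : Prop :=
  (\int[P]_x ((EFin \o V)^\+ x) < +oo)%E \/ (\int[P]_x ((EFin \o V)^\- x) < +oo)%E.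

(* expectation (as an extended real; meaningful when well-defined) *)
Definition expect (V : T -> R) : \bar R := (\int[P]_x (V x)%:E)%E.

Definition cx_le (U V : T -> R) : Prop :=
  forall u : R -> R, convex_fun u ->
    expect_welldef (u \o U) -> expect_welldef (u \o V) ->
    (expect (u \o U) <= expect (u \o V))%E.

Definition comonotonic_pair (X Y : T -> R) : Prop :=
  exists Z : T -> R, measurable_fun setT Z /\
  exists f g : R -> R,
    [/\ {homo f : a b / a <= b}, {homo g : a b / a <= b} &
        {ae P, forall x, X x = f (Z x) /\ Y x = g (Z x)}].

Definition comonotonic (n : nat) (X : 'I_n -> T -> R) : Prop :=
  forall i j, comonotonic_pair (X i) (X j).

Definition comonotonic_version (n : nat) (X X' : 'I_n -> T -> R) : Prop :=
  [/\ forall i, measurable_fun setT (X' i),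
      comonotonic X' &
      forall i (B : set R), measurable B ->
        P (X' i @^-1` B) = P (X i @^-1` B)].

End Defs.

(* Main.v *)
(* Idea.  Off a null set the vectors (Xco_i) are totally ordered by the sum S'
   of their coordinates, so every level k splits as k = sum q_i with all the
   hyperplanes x_i = q_i separating {S' <= k} from {S' >= k}.  Hence
   (S' - k)^+ = sum (Xco_i - q_i)^+ a.s., whereas (S - k)^+ <= sum (X_i - q_i)^+
   always, and the two right-hand sides have the same expectation: call payoffs
   satisfy the inequality in [0, +oo], without any integrability.
   A convex w >= 0 vanishing on a left half-line is a limit from below of
   positive combinations of calls, so Fatou's lemma gives E w(S) <= E w(S');
   by reflection the same holds for each convex v >= 0 that has a zero.  A
   general convex u is reached through v = max(u, c) - c with c at least some
   value of u, letting c decrease to inf u; if E u(S')^+ = +oo there is nothing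
   to prove. *)
Require Import Defs.
From HB Require Import structures.
From mathcomp Require Import all_boot all_order all_algebra.
From mathcomp Require Import all_classical all_reals all_analysis.
From mathcomp Require Import measurable_realfun ring lra.
Import Order.TTheory GRing.Theory Num.Theory.
Import numFieldNormedType.Exports.
Local Open Scope classical_set_scope.
Local Open Scope ring_scope.

(** * Convex functions on the line and their approximation by calls *)

Section ConvexFunctions.
Context {R : realType}.
Implicit Types u w : R -> R.

(** Clearing the denominator [z - x] keeps the degenerate case [x = z] and suits linear
    arithmetic. *)
Lemma convex_fun_chord {u x y z} : convex_fun u -> x <= y -> y <= z ->
  (z - x) * u y <= (z - y) * u x + (y - x) * u z.
Proof.
move=> cu xy yz; have [zx|zx] := eqVneq z x.
  have -> : y = x by lra.
  by rewrite zx !subrr !mul0r addr0.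
have xz : 0 < z - x by rewrite subr_gt0 lt_neqAle eq_sym zx (le_trans xy).
have t01 : 0 <= (z - y) / (z - x) <= 1.
  by rewrite divr_ge0 ?ler_pdivrMr //=; lra.
have := cu x z _ t01.
have -> : (z - y) / (z - x) * x + (1 - (z - y) / (z - x)) * z = y.
  by field; rewrite gt_eqF.
move=> /(ler_wpM2l (ltW xz)) /le_trans; apply.
by rewrite le_eqVlt; apply/orP; left; apply/eqP; field; rewrite gt_eqF.
Qed.

(** Convexity makes each strict sublevel set of [u] an interval, and these are the complements of
    the preimages of the generating rays. *)
Lemma measurable_convex_fun u : convex_fun u -> measurable_fun setT u.
Proof.
move=> cu; apply: (measurability _ (RGenCInfty.measurableE R)).
move=> _ [_ [a ->] <-]; rewrite setTI -[X in measurable X]setCK.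
apply: measurableC; apply: is_interval_measurable.
move=> x y /=; rewrite !in_itv/= !andbT => /negP; rewrite -ltNge => xa.
move=> /negP; rewrite -ltNge => ya z /andP[xz zy].
rewrite in_itv/= andbT; apply/negP; rewrite -ltNge.
have [yx|yx] := eqVneq y x; first by have -> : z = x by lra.
have xy : 0 < y - x by rewrite subr_gt0 lt_neqAle eq_sym yx (le_trans xz).
rewrite -(ltr_pM2l xy) (le_lt_trans (convex_fun_chord cu xz zy))//.
have [zx|zx] := eqVneq z x; first by rewrite zx; nra.
have xz' : 0 < z - x by rewrite subr_gt0 lt_neqAle eq_sym zx xz.
by nra.
Qed.

Section Ramp.
Variables (w : R -> R) (x0 : R).
Hypotheses (cw : convex_fun w) (w0 : forall x, x <= x0 -> w x = 0)
  (w_ge0 : forall x, 0 <= w x).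

(** At a point [z] left of both [x] and [x0] the value [w z] is zero, so the chord inequality
    through [z], [x], [y] compares [w x] with [w y] directly. *)
Let ramp_homo {x y} : x <= y -> w x <= w y.
Proof.
move=> xy; set z := Num.min x x0 - 1.
have zx : z < x by rewrite /z ltrBlDr ltr_pwDr// ge_min lexx.
have wz : w z = 0.
  by apply: w0; rewrite /z ltW// ltrBlDr ltr_pwDr// ge_min lexx orbT.
have := convex_fun_chord cw (ltW zx) xy; rewrite wz mulr0 add0r => H.
have yz : 0 < y - z by lra.
rewrite -(ler_pM2l yz) (le_trans H)// ler_wpM2r//; lra.
Qed.

(* Slope increments of the function equal to [w (x0 + j h - h)] at the nodes
   [x0 + j h] and affine in between: the delay by [h] is what keeps the call sum
   below [w]. *)
Definition call_weight h j : R :=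
  (w (x0 + j%:R * h) - w (x0 + j%:R * h - h) *+ 2
    + w (x0 + j%:R * h - h *+ 2)) / h.

Definition call_sum h N x : R :=
  \sum_(j < N) call_weight h j * Num.max (x - (x0 + j%:R * h)) 0.

(** The numerator is a second difference of [w] at equally spaced points. *)
Lemma call_weight_ge0 h j : 0 < h -> 0 <= call_weight h j.
Proof.
move=> h0; rewrite /call_weight; set k := x0 + _.
have H1 : k - h *+ 2 <= k - h by lra.
have H2 : k - h <= k by lra.
have := convex_fun_chord cw H1 H2.
have -> : k - (k - h *+ 2) = h * 2 by ring.
have -> : k - (k - h) = h by ring.
have -> : k - h - (k - h *+ 2) = h by ring.
rewrite -mulrA -mulrDr (ler_pM2l h0) => H.
by apply: divr_ge0; lra.
Qed.

(** Past the last node the slopes telescope to the latest difference quotient of [w]. In the base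
    case every value of [w] is taken at or left of [x0], hence zero. *)
Lemma call_sum_above h N x : 0 < h -> x0 + N%:R * h <= x ->
  call_sum h N.+1 x = w (x0 + N%:R * h - h)
    + (w (x0 + N%:R * h) - w (x0 + N%:R * h - h)) / h * (x - (x0 + N%:R * h)).
Proof.
move=> h0; elim: N x => [|N IH] x xN.
  rewrite /call_sum big_ord_recr big_ord0/= /call_weight.
  by rewrite !w0; [ring|lra..].
rewrite /call_sum big_ord_recr/=.
have xN' : x0 + N%:R * h <= x by move: xN; rewrite -natr1; lra.
rewrite [X in X + _](IH x xN') max_l ?subr_ge0// /call_weight.
have e1 : x0 + N.+1%:R * h - h = x0 + N%:R * h by rewrite -natr1; ring.
have e2 : x0 + N.+1%:R * h - h *+ 2 = x0 + N%:R * h - h by rewrite -natr1; ring.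
have e3 : x0 + N.+1%:R * h = x0 + N%:R * h + h by rewrite -natr1; ring.
by rewrite e2 e1 e3; field; rewrite gt_eqF.
Qed.

Lemma call_sum_below h N x : x <= x0 + N%:R * h ->
  call_sum h N.+1 x = call_sum h N x.
Proof.
by move=> xN; rewrite /call_sum big_ord_recr/= max_r ?subr_le0// mulr0 addr0.
Qed.

(** The last affine piece starts from [w (k - h) <= w k] with the slope of the chord over
    [[k - h, k]], and the extension of that chord beyond [k] stays below [w]. *)
Lemma call_sum_le h N x : 0 < h -> call_sum h N x <= w x.
Proof.
move=> h0; elim: N => [|N IH]; first by rewrite /call_sum big_ord0.
have [/ltW xN|xN] := ltP x (x0 + N%:R * h); first by rewrite call_sum_below.
rewrite call_sum_above//; set k := x0 + _ in xN *.
have H1 : k - h <= k by lra.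
have := convex_fun_chord cw H1 xN; have := ramp_homo H1.
have -> : k - (k - h) = h by ring.
set a := w (k - h); set b := w k => ab H.
rewrite -(ler_pM2l h0) (le_trans (y := h * b + (b - a) * (x - k)))//.
  have -> : h * (a + (b - a) / h * (x - k)) = h * a + (b - a) * (x - k).
    by field; rewrite gt_eqF.
  by rewrite lerD2r ler_pM2l.
move: H; lra.
Qed.

(** Shifted left by [h], each affine piece is a chord of [w], which lies above the graph. *)
Lemma call_sum_ge h N x : 0 < h -> x <= x0 + N%:R * h ->
  w (x - h) <= call_sum h N x.
Proof.
move=> h0; elim: N => [|N IH] xN.
  by rewrite /call_sum big_ord0 w0//; move: xN; lra.
have [/ltW xN'|xN'] := ltP x (x0 + N%:R * h).
  by rewrite call_sum_below// IH.
rewrite call_sum_above//.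
have : x <= x0 + N%:R * h + h by move: xN; rewrite -natr1; lra.
set k := x0 + _ in xN' * => xk.
have H1 : k - h <= x - h by lra.
have H2 : x - h <= k by lra.
have := convex_fun_chord cw H1 H2.
have -> : k - (k - h) = h by ring.
set a := w (k - h); set b := w k => H.
rewrite -(ler_pM2l h0).
have -> : h * (a + (b - a) / h * (x - k)) = h * a + (b - a) * (x - k).
  by field; rewrite gt_eqF.
move: H; lra.
Qed.

(** With mesh [1/(m+1)], the [(m+1)^2] calls cover every [x <= x0 + m + 1]: the mesh shrinks while
    the range grows. *)
Lemma call_sum_cvg x : call_sum m.+1%:R^-1 (m.+1 * m.+1) x @[m --> \oo] --> w x.
Proof.
(* By convexity [w] grows by at most [h * C] over [[x - h, x]], which controls the delay. *)
set C := w (x + 1) - w x.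
have lb : \forall m \near \oo, w x - m.+1%:R^-1 * C <=
    call_sum m.+1%:R^-1 (m.+1 * m.+1) x <= w x.
  near=> m; have h0 : 0 < m.+1%:R^-1 :> R by [].
  rewrite call_sum_le// andbT.
  apply: (le_trans (y := w (x - m.+1%:R^-1))).
    move: h0; set h := m.+1%:R^-1 => h0.
    have H1 : x - h <= x by lra.
    have H2 : x <= x + 1 by lra.
    have := convex_fun_chord cw H1 H2.
    have -> : x + 1 - (x - h) = 1 + h by ring.
    have -> : x + 1 - x = 1 by ring.
    have -> : x - (x - h) = h by ring.
    rewrite /C; move: (w x) (w (x - h)) (w (x + 1)) => a b c; lra.
  apply: call_sum_ge => //; rewrite natrM mulfK// -lerBlDl.
  rewrite (le_trans (y := m%:R)) ?ler_nat//.
  near: m; exact: nbhs_infty_ger.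
apply: (squeeze_cvgr lb); last exact: cvg_cst.
rewrite -[X in _ --> X]subr0; apply: cvgB; first exact: cvg_cst.
rewrite -(mul0r C); apply: cvgMl; exact: cvg_harmonic.
Unshelve. all: by end_near. Qed.

End Ramp.
End ConvexFunctions.

(** * Chains of vectors ordered by coordinate sums, and their separation *)

Section SumChains.
Context {R : realType} {n : nat}.
Hypothesis n_gt0 : (0 < n)%N.
Implicit Types (A C : set ('I_n -> R)) (x y a b : 'I_n -> R) (k : R).

(* The total order on a comonotonic set is read off the coordinate sums. *)
Definition sum_chain C :=
  forall x y, C x -> C y -> \sum_i x i <= \sum_i y i -> forall i, x i <= y i.

Let n_neq0 : n%:R != 0 :> R. Proof. by rewrite pnatr_eq0 -lt0n. Qed.

Let shift (a : 'I_n -> R) c : \sum_i (a i + c / n%:R) = \sum_i a i + c.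
Proof.
by rewrite big_split/= sumr_const card_ord -[X in _ + X]mulr_natr divfK.
Qed.

(** In a chain, a gap in one coordinate is at most the gap in the sums. An element whose sum is
    within [e / n] of [sup S] is thus within [e / n] of all coordinate suprema at once, whose sum
    then exceeds [sup S] by at most [e]. *)
Lemma sum_chain_lub A k : sum_chain A -> A !=set0 ->
    (forall x, A x -> \sum_i x i <= k) ->
  exists a, [/\ forall x, A x -> forall i, x i <= a i,
    \sum_i a i <= k &
    forall b, (forall x, A x -> forall i, x i <= b i) -> forall i, a i <= b i].
Proof.
move=> chA [x1 Ax1] Ak.
pose S := [set \sum_i x i | x in A].
have hS : has_sup S.
  by split; [exists (\sum_i x1 i), x1|exists k => _ [x Ax <-]; exact: Ak].
have SA x : A x -> \sum_i x i <= sup S.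
  by move=> Ax; apply: ub_le_sup; [exact: hS.2|exists x].
have lip x y i : A x -> A y -> y i <= x i + (sup S - \sum_j x j).
  move=> Ax Ay; have [yx|/ltW xy] := leP (\sum_j y j) (\sum_j x j).
    by rewrite (le_trans (chA _ _ Ay Ax yx i))// lerDl subr_ge0 SA.
  rewrite -lerBlDl (le_trans (y := \sum_j (y j - x j)))//.
    rewrite (bigD1 i)//= lerDl sumr_ge0// => j _.
    by rewrite subr_ge0 (chA _ _ Ax Ay xy).
  by rewrite sumrB lerB// SA.
pose a i := sup [set x i | x in A].
have hA i : has_sup [set x i | x in A].
  split; first by exists (x1 i), x1.
  by exists (x1 i + (sup S - \sum_j x1 j)) => _ [x Ax <-]; exact: lip.
exists a; split.
- by move=> x Ax i; apply: ub_le_sup; [exact: (hA i).2|exists x].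
- rewrite (le_trans (y := sup S))//; last first.
    by apply: ge_sup; [exact: hS.1|move=> _ [x Ax <-]; exact: Ak].
  apply/ler_addgt0Pr => e e0.
  have en : 0 < e / n%:R by rewrite divr_gt0// ltr0n.
  have [_ [x Ax <-] xs] := sup_adherent en hS.
  have : \sum_i a i <= \sum_i (x i + e / n%:R).
    apply: ler_sum => i _; apply: ge_sup; first exact: (hA i).1.
    by move=> _ [y Ay <-]; rewrite (le_trans (lip x y i Ax Ay))// lerD2l; lra.
  by rewrite shift => /le_trans; apply; rewrite lerD2r SA.
- move=> b Ab i; apply: ge_sup; first exact: (hA i).1.
  by move=> _ [x Ax <-]; exact: Ab.
Qed.

Lemma sum_chain_glb A k : sum_chain A -> A !=set0 ->
    (forall x, A x -> k <= \sum_i x i) ->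
  exists b, [/\ forall x, A x -> forall i, b i <= x i,
    k <= \sum_i b i &
    forall a, (forall x, A x -> forall i, a i <= x i) -> forall i, a i <= b i].
Proof.
move=> chA [x1 Ax1] Ak; pose N x i := - x i.
have NK x : N (N x) = x by apply/funext => i; rewrite /N opprK.
have sN x : \sum_i N x i = - \sum_i x i by rewrite sumrN.
have [||x /Ak|b [Ab bk bmin]] := @sum_chain_lub [set x | A (N x)] (- k).
- move=> x y /= Ax Ay xy i; rewrite -lerN2; apply: (chA _ _ Ay Ax).
  by rewrite !sN lerN2.
- by exists (N x1); rewrite /= NK.
- by rewrite sN lerNr.
exists (N b); split.
- by move=> x Ax i; rewrite lerNl; apply: (Ab (N x)); rewrite /= NK.
- by rewrite sN lerNr.
- move=> a Aa i; rewrite lerNr; apply: (bmin (N a)) => x /Aa xa j.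
  by rewrite lerNr; exact: xa.
Qed.

(** Elements with sum at most [k] lie below those with sum at least [k], so the supremum [a] of the
    former lies below the infimum [b] of the latter; [q] is taken on the segment from [a] to [b]. *)
Lemma sum_chain_split C k : sum_chain C -> C !=set0 ->
  exists2 q : 'I_n -> R, \sum_i q i = k & forall x, C x ->
    (\sum_i x i <= k -> forall i, x i <= q i) /\
    (k <= \sum_i x i -> forall i, q i <= x i).
Proof.
move=> chC [x1 Cx1].
pose A := [set x | C x /\ \sum_i x i <= k].
pose B := [set x | C x /\ k <= \sum_i x i].
have chA : sum_chain A by move=> x y [Cx _] [Cy _]; exact: chC.
have chB : sum_chain B by move=> x y [Cx _] [Cy _]; exact: chC.
have Ak x : A x -> \sum_i x i <= k by case.
have Bk x : B x -> k <= \sum_i x i by case.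
suff [q qk [Aq Bq]] : exists2 q : 'I_n -> R, \sum_i q i = k &
    (forall x, A x -> forall i, x i <= q i) /\
    (forall x, B x -> forall i, q i <= x i).
  by exists q => // x Cx; split => xk; [apply: Aq|apply: Bq].
(* If one side is empty, the bound of the other is corrected to sum [k] by an equal shift of all
   coordinates. *)
have [A0|An0] := eqVneq A set0; have [B0|Bn0] := eqVneq B set0.
- have [xk|/ltW xk] := leP (\sum_i x1 i) k.
    by have : A x1 by []; rewrite A0.
  by have : B x1 by []; rewrite B0.
- move/set0P: Bn0 => /(sum_chain_glb _ k chB)[]// b [Bb kb _].
  exists (fun i => b i + (k - \sum_i b i) / n%:R); first by rewrite shift; lra.
  split=> [x|x Bx i]; first by rewrite A0.
  by rewrite (le_trans _ (Bb x Bx i))// gerDl mulr_le0_ge0// subr_le0.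
- move/set0P: An0 => /(sum_chain_lub _ k chA)[]// a [Aa ka _].
  exists (fun i => a i + (k - \sum_i a i) / n%:R); first by rewrite shift; lra.
  split=> [x Ax i|x]; last by rewrite B0.
  by rewrite (le_trans (Aa x Ax i))// lerDl divr_ge0// subr_ge0.
move/set0P: An0 => /(sum_chain_lub _ k chA)[]// a [Aa ak amin].
move/set0P: Bn0 => /(sum_chain_glb _ k chB)[]// b [Bb kb bmax].
have ab i : a i <= b i.
  apply: bmax => y By {}i; apply: amin => x Ax {}i.
  by apply: (chC _ _ Ax.1 By.1); rewrite (le_trans Ax.2 By.2).
(* If the two sums coincide, division by zero gives [t = 0], so [q = a], whose sum is then squeezed
   to [k]. *)
pose t := (k - \sum_i a i) / (\sum_i b i - \sum_i a i).
have t01 : 0 <= t <= 1.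
  rewrite /t; have [->|] := eqVneq (\sum_i b i - \sum_i a i) 0.
    by rewrite invr0 mulr0 lexx ler01.
  move=> sab; have {}sab : 0 < \sum_i b i - \sum_i a i.
    by rewrite lt_neqAle eq_sym sab subr_ge0 (le_trans ak).
  by rewrite ler_pdivrMr// mul1r lerB// divr_ge0 ?(ltW sab)// subr_ge0.
case/andP: t01 => t0 t1.
exists (fun i => a i + t * (b i - a i)).
  rewrite big_split/= -mulr_sumr sumrB /t.
  have [sab|sab] := eqVneq (\sum_i b i - \sum_i a i) 0; last first.
    by rewrite divfK// addrC subrK.
  rewrite sab mulr0 addr0; apply/eqP; rewrite eq_le ak (le_trans kb)//.
  by rewrite -subr_le0 sab.
split=> [x Ax i|x Bx i].
  by rewrite (le_trans (Aa x Ax i))// lerDl mulr_ge0// subr_ge0.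
apply: le_trans (Bb x Bx i); rewrite -lerBrDl -[leRHS]mul1r.
by rewrite ler_wpM2r// subr_ge0.
Qed.

End SumChains.

(** * Comonotonic vectors and calls on their sums *)

Section Comonotonic.
Context {R : realType} {d : measure_display} {T : measurableType d}.
Variable P : probability T R.

(** Off the finitely many null sets of the pairs, no two coordinates move in strictly opposite
    directions. If coordinate [i] were larger at [x] than at [y], all others would be at least as
    large, and so the sum would be larger too. *)
Lemma comonotonic_ae_chain n (X : 'I_n -> T -> R) : comonotonic P X ->
  exists2 G : set T, {ae P, forall x, G x} &
    sum_chain [set (fun i => X i x) | x in G].
Proof.
move=> coX.
have /choice[G GP] : forall ij : 'I_n * 'I_n, exists G : set T,
    {ae P, forall x, G x} /\
    forall x y, G x -> G y -> X ij.1 x < X ij.1 y -> X ij.2 x <= X ij.2 y.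
  move=> [i j]; have [Z [_ [f [g [fh gh fg]]]]] := coX i j.
  exists [set x | X i x = f (Z x) /\ X j x = g (Z x)]; split => //.
  move=> x y [/= -> ->] [-> ->] fxy; apply: gh; rewrite leNgt; apply/negP.
  by move=> /ltW /fh; rewrite leNgt fxy.
exists [set x | forall ij, G ij x].
  by apply: filter_forall => ij; exact: (GP ij).1.
move=> _ _ [x Gx <-] [y Gy <-] xy i; rewrite leNgt; apply/negP => yx.
suff : \sum_i X i y < \sum_i X i x by rewrite ltNge xy.
rewrite (bigD1 i)//= [ltRHS](bigD1 i)//=; apply: ltr_leD => //.
apply: ler_sum => j _; exact: ((GP (i, j)).2 y x (Gy _) (Gx _)).
Qed.

Lemma expect_eq_law (X Y : T -> R) (f : R -> R) :
  measurable_fun setT X -> measurable_fun setT Y ->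
  (forall B, measurable B -> P (X @^-1` B) = P (Y @^-1` B)) ->
  measurable_fun setT f -> (forall x, 0 <= f x) ->
  expect P (f \o X) = expect P (f \o Y).
Proof.
move=> mX mY XY mf f0.
pose X' : {RV P >-> R} := HB.pack X (isMeasurableFun.Build _ _ _ _ X mX).
pose Y' : {RV P >-> R} := HB.pack Y (isMeasurableFun.Build _ _ _ _ Y mY).
have mEf : measurable_fun setT (fun y => (f y)%:E) by exact/measurable_EFinP.
have Ef0 y : (0 <= (f y)%:E)%E by rewrite lee_fin.
transitivity (\int[distribution P X']_y (f y)%:E)%E.
  by rewrite ge0_integral_distribution.
transitivity (\int[distribution P Y']_y (f y)%:E)%E.
  by apply: eq_measure_integral => A mA _; exact: XY.
by rewrite ge0_integral_distribution.
Qed.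

Lemma measurable_call {d'} {T' : measurableType d'} (X : T' -> R) k :
  measurable_fun setT X ->
  measurable_fun setT (fun x => Num.max (X x - k) 0).
Proof.
move=> mX; apply: measurable_maxr => //.
exact: measurable_funB.
Qed.

Lemma comonotonic_version_measurable n (X Y : 'I_n -> T -> R) :
  comonotonic_version P X Y -> measurable_fun setT (fun x => \sum_i Y i x).
Proof. by case=> mY _ _; exact: measurable_sum. Qed.

Lemma comonotonic_call_le n (X Y : 'I_n -> T -> R) k :
  (0 < n)%N -> (forall i, measurable_fun setT (X i)) ->
  comonotonic_version P X Y ->
  (expect P (fun x => Num.max (\sum_i X i x - k) 0)%R <=
   expect P (fun x => Num.max (\sum_i Y i x - k) 0)%R)%E.
Proof.
move=> n0 mX [mY coY lawY].
have [G aeG chG] := comonotonic_ae_chain _ Y coY.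
have [x0 Gx0] : exists x, G x.
  have PT : (0 < P setT)%E by rewrite probability_setT.
  exact: (@filter_ex _ _ (ae_properfilter_algebraOfSetsType PT) _ aeG).
have [|q qk Cq] := sum_chain_split n0 _ k chG; first by exists (Y^~ x0), x0.
have mS (Z : 'I_n -> T -> R) : (forall i, measurable_fun setT (Z i)) ->
    measurable_fun setT (fun x => (\sum_i Num.max (Z i x - q i) 0)%:E).
  move=> mZ; apply/measurable_EFinP/measurable_sum => i.
  exact: measurable_call.
have ES (Z : 'I_n -> T -> R) : (forall i, measurable_fun setT (Z i)) ->
    expect P (fun x => \sum_i Num.max (Z i x - q i) 0) =
    (\sum_i expect P (fun x => Num.max (Z i x - q i) 0)%R)%E.
  move=> mZ; rewrite -ge0_integral_sum//.
  - by apply: eq_integral => x _; rewrite sumEFin.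
  - by move=> i; exact/measurable_EFinP/measurable_call.
  - by move=> i x _; rewrite lee_fin le_max lexx orbT.
apply: (@le_trans _ _ (expect P (fun x => \sum_i Num.max (X i x - q i) 0))).
  apply: ge0_le_integral => //.
  - by move=> x _; rewrite lee_fin le_max lexx orbT.
  - exact/measurable_EFinP/measurable_call/measurable_sum.
  - exact: mS.
  - move=> x _; rewrite lee_fin -qk -sumrB ge_max.
    apply/andP; split; last by apply: sumr_ge0 => i _; rewrite le_max lexx orbT.
    by apply: ler_sum => i _; rewrite le_max lexx.
rewrite (ES X)//.
have -> : (\sum_i expect P (fun x => Num.max (X i x - q i) 0)%R =
    \sum_i expect P (fun x => Num.max (Y i x - q i) 0)%R)%E.
  apply: eq_bigr => i _.
  apply: (expect_eq_law (X i) (Y i) (fun x => Num.max (x - q i) 0)) => //.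
  - by move=> B mB; rewrite lawY.
  - exact: measurable_call.
  - by move=> x; rewrite le_max lexx orbT.
rewrite -ES//; apply: ae_ge0_le_integral => //.
- by move=> x _; rewrite lee_fin sumr_ge0// => i _; rewrite le_max lexx orbT.
- exact: mS.
- by move=> x _; rewrite lee_fin le_max lexx orbT.
- exact/measurable_EFinP/measurable_call/measurable_sum.
apply: filterS aeG => x Gx _; rewrite lee_fin.
have [hle hge] := Cq (Y^~ x) (ex_intro2 _ _ x Gx erefl).
have [Sk|/ltW kS] := leP (\sum_i Y i x) k.
  rewrite big1 ?le_max ?lexx ?orbT// => i _.
  by apply/max_idPr; rewrite subr_le0; exact: hle.
rewrite le_max -{1}qk -sumrB; apply/orP; left; apply: ler_sum => i _.
by rewrite ge_max lexx subr_ge0 hge.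
Qed.

(** Conjugation by negation keeps [f] and [g] increasing, now as functions of [- Z]. *)
Lemma comonotonic_version_opp n (X Y : 'I_n -> T -> R) :
  comonotonic_version P X Y ->
  comonotonic_version P (fun i x => - X i x) (fun i x => - Y i x).
Proof.
case=> mY coY lawY; split.
- by move=> i; exact: measurable_funN.
- move=> i j; have [Z [mZ [f [g [fh gh fg]]]]] := coY i j.
  exists (fun x => - Z x); split; first exact: measurable_funN.
  exists (fun z => - f (- z)), (fun z => - g (- z)); split.
  + by move=> a b ab; rewrite lerN2 fh// lerN2.
  + by move=> a b ab; rewrite lerN2 gh// lerN2.
  + by apply: filterS fg => x [-> ->]; rewrite opprK.
- move=> i B mB; apply: (lawY i (-%R @^-1` B)).
  rewrite -[X in measurable X]setTI; exact: (@oppr_measurable R setT).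
Qed.

End Comonotonic.

(** * From calls to nonnegative convex functions with a zero *)

Section ConvexOrder.
Context {R : realType} {d : measure_display} {T : measurableType d}.
Variable P : probability T R.

(** Nonnegative weights make linearity valid in [[0, +oo]], even for calls of infinite
    expectation. *)
Lemma expect_call_sum (w : R -> R) x0 h N (S : T -> R) :
  convex_fun w -> 0 < h -> measurable_fun setT S ->
  expect P (call_sum w x0 h N \o S) =
  (\sum_(j < N) (call_weight w x0 h j)%:E *
     expect P (fun x => Num.max (S x - (x0 + j%:R * h)) 0)%R)%E.
Proof.
move=> cw h0 mS.
transitivity (\int[P]_x \sum_(j < N) ((call_weight w x0 h j)%:E *
    (Num.max (S x - (x0 + j%:R * h)) 0)%R%:E))%E.
  by apply: eq_integral => x _; rewrite sumEFin.
have mC j : measurable_fun setT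
    (fun x => (Num.max (S x - (x0 + j%:R * h)) 0)%:E).
  exact/measurable_EFinP/measurable_call.
have C0 j x : (0 <= (Num.max (S x - (x0 + j%:R * h)) 0)%:E)%E.
  by rewrite lee_fin le_max lexx orbT.
have cw0 j : 0 <= call_weight w x0 h j by exact: call_weight_ge0.
rewrite ge0_integral_sum//.
- by apply: eq_bigr => j _; rewrite ge0_integralZl_EFin.
- by move=> j; apply: emeasurable_funM => //; exact: mC.
- by move=> j x _; rewrite mule_ge0// lee_fin.
Qed.

Section Versions.
Variables (n : nat) (X Y : 'I_n -> T -> R).
Hypotheses (n0 : (0 < n)%N) (mX : forall i, measurable_fun setT (X i))
  (XY : comonotonic_version P X Y).
Let S x := \sum_i X i x.
Let S' x := \sum_i Y i x.
Let mS : measurable_fun setT S. Proof. exact: measurable_sum. Qed.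
Let mS' : measurable_fun setT S'.
Proof. exact: comonotonic_version_measurable XY. Qed.

(** Convergence of the call sums serves only on the side of [S], through Fatou; on the side of [S']
    the bound [call_sum_le] suffices. *)
Lemma comonotonic_ramp_le (w : R -> R) x0 : convex_fun w ->
  (forall x, x <= x0 -> w x = 0) -> (forall x, 0 <= w x) ->
  (expect P (w \o S) <= expect P (w \o S'))%E.
Proof.
move=> cw w0 w_ge0.
pose L m := call_sum w x0 m.+1%:R^-1 (m.+1 * m.+1).
have L0 m x : 0 <= L m x.
  rewrite sumr_ge0// => j _; rewrite mulr_ge0 ?call_weight_ge0//.
  by rewrite le_max lexx orbT.
have mL m (Z : T -> R) : measurable_fun setT Z ->
    measurable_fun setT (fun x => (L m (Z x))%:E).
  move=> mZ; apply/measurable_EFinP/measurable_sum => j.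
  by apply: measurable_funM => //; exact: measurable_call.
have mw := measurable_convex_fun _ cw.
have -> : expect P (w \o S) = (\int[P]_x limn_einf (fun m => (L m (S x))%:E))%E.
  apply: eq_integral => x _; symmetry; apply: (cvg_limn_einf_sup _).1.
  apply/cvg_EFin; first by near=> m.
  exact: call_sum_cvg.
apply: le_trans (fatou P measurableT (fun m => mL m S mS) _) _.
  by move=> m x _; rewrite lee_fin.
rewrite limn_einf_lim; apply: lime_le; first exact: is_cvg_einfs.
near=> m; set E := (X in einfs X).
apply: (@le_trans _ _ (E m)); first by apply: ereal_inf_lbound; exists m => /=.
apply: (@le_trans _ _ (expect P (L m \o S'))).
  rewrite [leLHS](_ : _ = expect P (L m \o S))// !expect_call_sum//.
  apply: lee_sum => j _; rewrite lee_wpmul2l ?lee_fin ?call_weight_ge0//.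
  exact: comonotonic_call_le.
apply: ge0_le_integral => //.
- by move=> x _; rewrite lee_fin; exact: L0.
- exact: mL.
- by apply/measurable_EFinP; exact: measurableT_comp.
- by move=> x _; rewrite lee_fin; exact: call_sum_le.
Unshelve. all: by end_near. Qed.

End Versions.

(** Cut at its zero [x0], [v] is a ramp rising to the right plus one rising to the left; the latter
    is a right ramp in the negated vectors. *)
Lemma comonotonic_touching_le n (X Y : 'I_n -> T -> R) (v : R -> R) x0 :
  (0 < n)%N -> (forall i, measurable_fun setT (X i)) ->
  comonotonic_version P X Y -> convex_fun v -> (forall x, 0 <= v x) ->
  v x0 = 0 ->
  (expect P (fun x => v (\sum_i X i x)%R) <=
   expect P (fun x => v (\sum_i Y i x)%R))%E.
Proof.
move=> n0 mX XY cv v_ge0 vx0.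
have v_up (x y : R) : x0 <= x -> x <= y -> v x <= v y.
  move=> x0x xy; have := convex_fun_chord cv x0x xy; rewrite vx0 mulr0 add0r.
  have [yx0|yx0] := eqVneq y x0; first by have -> : x = y by lra.
  have yx : 0 < y - x0 by rewrite subr_gt0 lt_neqAle eq_sym yx0 (le_trans x0x).
  by move=> H; rewrite -(ler_pM2l yx) (le_trans H)// ler_wpM2r// lerD2r.
have v_down (x y : R) : y <= x0 -> x <= y -> v y <= v x.
  move=> yx0 xy; have := convex_fun_chord cv xy yx0; rewrite vx0 mulr0 addr0.
  have [xx0|xx0] := eqVneq x x0; first by have -> : y = x by lra.
  have yx : 0 < x0 - x by rewrite subr_gt0 lt_neqAle xx0 (le_trans xy).
  by move=> H; rewrite -(ler_pM2l yx) (le_trans H)// ler_wpM2r// lerD2l lerN2.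
pose w z := v (Num.max z x0).
pose w' z := v (- Num.max z (- x0)).
have max_cvx (c x y t : R) : 0 <= t <= 1 ->
    Num.max (t * x + (1 - t) * y) c <= t * Num.max x c + (1 - t) * Num.max y c.
  move=> /andP[t0 t1]; have t1' : 0 <= 1 - t by rewrite subr_ge0.
  rewrite ge_max !lerD ?ler_wpM2l ?le_max ?lexx//=.
  rewrite [leLHS](_ : c = t * c + (1 - t) * c); last by ring.
  by apply: lerD; rewrite ler_wpM2l// le_max lexx orbT.
have cw : convex_fun w.
  move=> x y t t01; apply: le_trans (cv _ _ _ t01); apply: v_up.
    by rewrite le_max lexx orbT.
  exact: max_cvx.
have cw' : convex_fun w'.
  move=> x y t t01; apply: le_trans (cv _ _ _ t01); apply: v_down.
    by rewrite lerNl le_max lexx orbT.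
  by rewrite !mulrN -opprD lerN2 max_cvx.
have mw := measurable_convex_fun _ cw.
have mw' := measurable_convex_fun _ cw'.
have split (Z : 'I_n -> T -> R) : (forall i, measurable_fun setT (Z i)) ->
    expect P (fun x => v (\sum_i Z i x)%R) =
    (expect P (w \o (fun x => \sum_i Z i x)%R) +
     expect P (w' \o (fun x => \sum_i - Z i x)%R))%E.
  move=> mZ; rewrite -ge0_integralD//.
  (* One of the two clamped arguments is always [x0], where [v] vanishes. *)
  - apply: eq_integral => x _; rewrite -EFinD /= sumrN /w /w'.
    rewrite -oppr_min opprK; case: leP => _; by rewrite vx0 ?addr0 ?add0r.
  - by move=> x _; rewrite lee_fin v_ge0.
  - apply/measurable_EFinP; apply: measurableT_comp => //.
    exact: measurable_sum.
  - by move=> x _; rewrite lee_fin v_ge0.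
  - apply/measurable_EFinP; apply: measurableT_comp => //.
    by apply: measurable_sum => i; exact: measurable_funN.
rewrite !split//; last by case: XY.
apply: leeD.
- apply: (comonotonic_ramp_le _ X Y n0 mX XY w x0 cw) => x; last exact: v_ge0.
  by move=> xx0; rewrite /w max_r.
- apply: (comonotonic_ramp_le _ (fun i x => - X i x) (fun i x => - Y i x)
    n0 _ (comonotonic_version_opp _ _ _ _ XY) w' (- x0) cw') => [i|x|x].
  + exact: measurable_funN.
  + by move=> xx0; rewrite /w' max_r ?opprK.
  + exact: v_ge0.
Qed.

(* The floor [c] makes [max (u, c) - c] vanish at [x0], whatever the behaviour
   of [u] at infinity. *)
Lemma comonotonic_floor_le n (X Y : 'I_n -> T -> R) (u : R -> R) c x0 :
  (0 < n)%N -> (forall i, measurable_fun setT (X i)) ->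
  comonotonic_version P X Y -> convex_fun u -> u x0 <= c ->
  (expect P (fun x => Num.max (u (\sum_i X i x)) c - c)%R <=
   expect P (fun x => Num.max (u (\sum_i Y i x)) c - c)%R)%E.
Proof.
move=> n0 mX XY cu ux0.
apply: (comonotonic_touching_le _ X Y (fun z => Num.max (u z) c - c) x0) => //.
- move=> x y t /[dup] t01 /andP[t0 t1].
  have t1' : 0 <= 1 - t by rewrite subr_ge0.
  rewrite lerBlDr ge_max; apply/andP; split.
    rewrite (le_trans (cu _ _ _ t01))//.
    rewrite -[leRHS](_ : t * Num.max (u x) c + (1 - t) * Num.max (u y) c = _).
      by rewrite lerD ?ler_wpM2l// le_max lexx.
    by ring.
  rewrite lerDr addr_ge0// mulr_ge0// subr_ge0 le_max lexx orbT//.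
- by move=> x; rewrite subr_ge0 le_max lexx orbT.
- by rewrite max_r// subrr.
Qed.

End ConvexOrder.

(** * Expectations through positive and negative parts *)

Section Expectation.
Context {R : realType} {d : measure_display} {T : measurableType d}.
Variable P : probability T R.
Implicit Types f g : T -> R.

Lemma funeposE_fin f : (EFin \o f)^\+%E = EFin \o (fun x => Num.max (f x) 0).
Proof. by apply/funext => x; rewrite funeposE /= EFin_max. Qed.

Lemma funenegE_fin f : (EFin \o f)^\-%E = EFin \o (fun x => Num.max (- f x) 0).
Proof. by apply/funext => x; rewrite funenegE /= EFin_max EFinN. Qed.

Lemma expectE f : expect P f =
  (expect P (fun x => Num.max (f x) 0)%R -
   expect P (fun x => Num.max (- f x) 0)%R)%E.
Proof.
rewrite /expect [LHS]integralE -[X in X^\+%E]/(EFin \o f).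
by rewrite -[X in X^\-%E]/(EFin \o f) funeposE_fin funenegE_fin.
Qed.

Lemma expect_ge0 f : (forall x, 0 <= f x) -> (0 <= expect P f)%E.
Proof. by move=> f0; apply: integral_ge0 => x _; rewrite lee_fin. Qed.

Lemma expectD f g : measurable_fun setT f -> measurable_fun setT g ->
  (forall x, 0 <= f x) -> (forall x, 0 <= g x) ->
  expect P (fun x => f x + g x) = (expect P f + expect P g)%E.
Proof.
move=> mf mg f0 g0; rewrite -ge0_integralD//.
- by move=> x _; rewrite lee_fin.
- exact/measurable_EFinP.
- by move=> x _; rewrite lee_fin.
- exact/measurable_EFinP.
Qed.

Lemma expect_cst (c : R) : expect P (fun=> c) = c%:E.
Proof.
rewrite -[RHS]mule1 -(probability_setT P).
exact: (integral_cst P measurableT c%:E).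
Qed.

Lemma ge0_expect_le f g : measurable_fun setT f -> measurable_fun setT g ->
  (forall x, 0 <= f x) -> (forall x, f x <= g x) ->
  (expect P f <= expect P g)%E.
Proof.
move=> mf mg f0 fg; apply: ge0_le_integral => //.
- by move=> x _; rewrite lee_fin.
- exact/measurable_EFinP.
- exact/measurable_EFinP.
- by move=> x _; rewrite lee_fin.
Qed.

Lemma expect_trunc_sup f (b : \bar R) : measurable_fun setT f ->
  (forall x, 0 <= f x) ->
  (forall m : nat, expect P (fun x => Num.min (f x) m%:R)%R <= b)%E ->
  (expect P f <= b)%E.
Proof.
move=> mf f0 fb.
have cf x : (Num.min (f x) m%:R)%:E @[m --> \oo] --> (f x)%:E.
  apply/cvg_EFin; first by near=> m.
  apply: cvg_near_cst; near=> m; apply/min_idPl.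
  near: m; exact: nbhs_infty_ger.
have mm m : measurable_fun setT (fun x => (Num.min (f x) m%:R)%:E).
  by apply/measurable_EFinP/measurable_minr.
have -> : expect P f = (\int[P]_x limn (fun m => (Num.min (f x) m%:R)%:E))%E.
  by apply: eq_integral => x _; rewrite (cvg_lim _ (cf x)).
have m0 m x : [set: T] x -> (0 <= (Num.min (f x) m%:R)%:E)%E.
  by move=> _; rewrite lee_fin le_min f0 /=.
have nd x : [set: T] x ->
    {homo (fun m => (Num.min (f x) m%:R)%:E) : m k / (m <= k)%N >-> (m <= k)%E}.
  move=> _ m k mk; rewrite lee_fin le_min ge_min lexx/= ge_min.
  by rewrite ler_nat mk orbT.
rewrite monotone_convergence//; apply: lime_le; last by near=> m; exact: fb.
apply: ereal_nondecreasing_is_cvgn => m k mk; apply: ge0_le_integral => //.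
- by move=> x Tx; exact: m0.
- by move=> x Tx; exact: nd.
Unshelve. all: by end_near. Qed.

End Expectation.

(** * General convex functions by lowering the floor *)

(** If [u] reaches down to [m], then [c = m] works. Otherwise [u] is bounded below and [c] is a
    value of [u] within [e] of its infimum. *)
Lemma convex_floor {R : realType} (u : R -> R) (m e : R) : 0 < e ->
  exists c x0 : R, u x0 <= c /\
    forall y : R, Num.max (u y) c <= Num.max (u y) m + e.
Proof.
move=> e0; have [[x0 ux0]|nex] := pselect (exists x0, u x0 <= m).
  by exists m, x0; split => // y; rewrite lerDl ltW.
have um y : m < u y by rewrite ltNge; apply/negP => uy; apply: nex; exists y.
have hi : has_inf (range u).
  split; first by exists (u 0), 0.
  by exists m => _ [y _ <-]; exact/ltW.
have [_ [x0 _ <-] ux0] := inf_adherent e0 hi.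
exists (u x0), x0; split => // y.
rewrite [in leRHS]max_l ?(ltW (um y))// ge_max lerDl (ltW e0)/=.
rewrite (le_trans (ltW ux0))// lerD2r.
by apply: ge_inf; [exact: hi.2|exists y].
Qed.

(** The negative part that survives flooring [v] at [- r] is its truncation at [r]. *)
Lemma floor_splitting {R : realType} (v r : R) : 0 <= r ->
  Num.max v (- r) + Num.min (Num.max (- v) 0) r = Num.max v 0.
Proof.
move=> r0; have [v0|v0] := leP v 0; last first.
  by rewrite max_l ?max_r ?min_l//; lra.
rewrite (max_l (x := - v)); last by lra.
by case: (leP v (- r)) => vr; [rewrite min_r|rewrite min_l]; lra.
Qed.

Theorem theorem5 (R : realType) (d : measure_display) (T : measurableType d)
  (P : probability T R) (hP : atomless P) (n : nat)
  (X Xco : 'I_n -> T -> R)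
  (hX : forall i, measurable_fun setT (X i))
  (hco : comonotonic_version P X Xco) :
  cx_le P (fun x => \sum_(i < n) X i x) (fun x => \sum_(i < n) Xco i x).
Proof.
case: n => [|n] in X Xco hX hco *.
  move=> u _ _ _; rewrite le_eqVlt; apply/orP; left; apply/eqP.
  by congr (expect P _); apply/funext => x /=; rewrite !big_ord0.
have mS' := comonotonic_version_measurable P _ X Xco hco.
have mS : measurable_fun setT (fun x => \sum_i X i x) by exact: measurable_sum.
move=> u cu _ wdV; have mu := measurable_convex_fun _ cu.
set U := u \o _; set V := u \o _ in wdV *.
have mU : measurable_fun setT U by exact: measurableT_comp.
have mV : measurable_fun setT V by exact: measurableT_comp.
pose pos (f : T -> R) x := Num.max (f x) 0.
pose neg (f : T -> R) x := Num.max (- f x) 0.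
have pos_ge0 f x : 0 <= pos f x by rewrite le_max lexx orbT.
have neg_ge0 f x : 0 <= neg f x by rewrite le_max lexx orbT.
have mpos f : measurable_fun setT f -> measurable_fun setT (pos f).
  by move=> mf; exact: measurable_maxr.
have mneg f : measurable_fun setT f -> measurable_fun setT (neg f).
  by move=> mf; apply: measurable_maxr => //; exact: measurable_funN.
have posneg f x : f x = pos f x - neg f x.
  by rewrite /pos /neg; case: (leP (f x) 0); case: (leP (- f x) 0); lra.
have [Vy|Vfin] := eqVneq (expect P (pos V)) +oo%E.
  have Vn : (expect P (neg V) < +oo)%E.
    case: wdV; rewrite ?funenegE_fin// funeposE_fin.
    by rewrite -[X in (X < _)%E]/(expect P (pos V)) Vy ltxx.
  rewrite [leRHS]expectE -/(pos V) -/(neg V) Vy.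
  by rewrite addye ?leey// eqe_oppLR /= lt_eqF.
have {}Vfin : expect P (pos V) \is a fin_num.
  by rewrite ge0_fin_numE ?expect_ge0// lt_neqAle Vfin leey.
(* By the convention that adding [-oo] always gives [-oo], the left-hand side is then [-oo]. *)
have [Uy|Ufin] := eqVneq (expect P (neg U)) +oo%E.
  by rewrite expectE -/(neg U) Uy addeNy leNye.
have {}Ufin : expect P (neg U) \is a fin_num.
  by rewrite ge0_fin_numE ?expect_ge0// lt_neqAle Ufin leey.
(* The claim rearranged without subtraction, [neg V] being truncated at [m] to match a floor at
   [- m]. The case [m = 0] shows that [pos U] has finite expectation; letting [m] grow restores
   [neg V]. *)
suff trunc (m : nat) : (expect P (fun x => Num.min (neg V x) m%:R)%R +
      expect P (pos U) <= expect P (pos V) + expect P (neg U))%E.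
  have sumfin : (expect P (pos V) + expect P (neg U))%E \is a fin_num.
    by rewrite fin_numD Vfin.
  have pUfin : expect P (pos U) \is a fin_num.
    rewrite ge0_fin_numE ?expect_ge0//.
    apply: (@le_lt_trans _ _ (expect P (pos V) + expect P (neg U))%E).
      apply: le_trans (trunc 0); rewrite leeDr// expect_ge0// => x.
      by rewrite le_min neg_ge0/=.
    by rewrite ltey_eq sumfin.
  have : (expect P (neg V) <=
      expect P (pos V) + expect P (neg U) - expect P (pos U))%E.
    apply: expect_trunc_sup => // [|m]; first exact: mneg.
    by rewrite leeBrDr.
  move=> VU; rewrite [leLHS]expectE [leRHS]expectE.
  rewrite -/(pos V) -/(neg V) -/(pos U) -/(neg U).
  have V0 : (0 <= expect P (neg V))%E by exact: expect_ge0.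
  move: VU V0 pUfin Vfin Ufin.
  case: (expect P (neg V)) => [a| |]; case: (expect P (pos U)) => [b| |];
    case: (expect P (pos V)) => [c| |]; case: (expect P (neg U)) => [f| |] //=.
  rewrite -!EFinD !lee_fin; lra.
(* Every term moved across an inequality below is nonnegative: [c] itself is
   split as [cp - cm], so that expectations may be added freely. *)
apply/lee_addgt0Pr => e e0.
have [c [x0 [ux0 uc]]] := convex_floor u (- m%:R) e e0.
have floor_le := comonotonic_floor_le P _ X Xco u c x0 (ltn0Sn n) hX hco cu ux0.
pose F (W : T -> R) x := Num.max (W x) c - c.
have F0 W x : 0 <= F W x by rewrite subr_ge0 le_max lexx orbT.
have mF W : measurable_fun setT W -> measurable_fun setT (F W).
  by move=> mW; apply: measurable_funB => //; exact: measurable_maxr.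
pose N x := Num.min (neg V x) m%:R.
have N0 x : 0 <= N x by rewrite le_min neg_ge0/=.
have mN : measurable_fun setT N by apply: measurable_minr => //; exact: mneg.
pose cp := Num.max c 0; pose cm := Num.max (- c) 0.
have cp0 : 0 <= cp by rewrite le_max lexx orbT.
have cm0 : 0 <= cm by rewrite le_max lexx orbT.
have cpm : c = cp - cm.
  by rewrite /cp /cm; case: (leP c 0); case: (leP (- c) 0); lra.
(* Combines [max (V, c) <= max (V, - m) + e] with the splitting of [pos V] at [- m]. *)
have {}uc x : F V x + (N x + cp) <= pos V x + (e + cm).
  have m0 : 0 <= m%:R :> R by [].
  have : Num.max (V x) (- m%:R) + N x = pos V x by exact: floor_splitting.
  move: (uc (\sum_i Xco i x)); rewrite -/(V x) /F; lra.
have lowU x : pos U x + cm <= F U x + (cp + neg U x).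
  have : U x <= Num.max (U x) c by rewrite le_max lexx.
  by have := posneg U x; rewrite /F; lra.
have H1 : (expect P (pos U) + cm%:E <=
    expect P (F U) + (cp%:E + expect P (neg U)))%E.
  rewrite -(expect_cst P cm) -(expect_cst P cp) -!expectD//;
    do ?[exact: mpos|exact: mneg|exact: mF|exact: measurable_cst].
  - apply: ge0_expect_le => //.
    + by apply: measurable_funD => //; exact: mpos.
    + apply: measurable_funD; first exact: mF.
      by apply: measurable_funD => //; exact: mneg.
    + by move=> x; rewrite addr_ge0.
  - by apply: measurable_funD => //; exact: mneg.
  - by move=> x; rewrite addr_ge0.
have H2 : (expect P (F V) + (expect P N + cp%:E) <=
    expect P (pos V) + (e + cm)%:E)%E.
  rewrite -(expect_cst P (e + cm)) -(expect_cst P cp) -!expectD//;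
    do ?[exact: mpos|exact: mneg|exact: mF|exact: measurable_cst].
  - apply: ge0_expect_le => //.
    + by apply: measurable_funD; [exact: mF|exact: measurable_funD].
    + by apply: measurable_funD => //; exact: mpos.
    + by move=> x; apply: addr_ge0 => //; exact: addr_ge0.
  - by move=> _; rewrite addr_ge0// ltW.
  - exact: measurable_funD.
  - by move=> x; rewrite addr_ge0.
have FU0 : (0 <= expect P (F U))%E by exact: expect_ge0.
have FV0 : (0 <= expect P (F V))%E by exact: expect_ge0.
have EN0 : (0 <= expect P N)%E by exact: expect_ge0.
have pU0 : (0 <= expect P (pos U))%E by exact: expect_ge0.
move: floor_le; rewrite -[X in (X <= _)%E]/(expect P (F U)).
rewrite -[X in (_ <= X)%E]/(expect P (F V)) -/N.
move: H1 H2 FU0 FV0 EN0 pU0 Vfin Ufin.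
(* The right-hand side of [H2] is finite, so [F V] and [N] have finite expectations; [floor_le] and
   [H1] pass this on to [F U] and [pos U]. When the three inequalities are added, [cp] and [cm]
   cancel. *)
case: (expect P (F U)) => [a| |] //; case: (expect P (F V)) => [b| |] //;
case: (expect P N) => [q| |] //; case: (expect P (pos U)) => [r| |] //;
case: (expect P (pos V)) => [s| |] //; case: (expect P (neg U)) => [t| |] //.
by rewrite -!EFinD !lee_fin; lra.
Qed.
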